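(* Let $\|\cdot\|$ be a norm on $\mathbb{R}^d$, with associated coordinate-$k$ norms $\|\cdot\|_{(k)}$ (unit balls $B_{(k)}$) and dual coordinate-$k$ norms $\|\cdot\|_{(k),\star}$ (unit balls $B_{(k),\star}$), $k\in\{1,\dots,d\}$, with the convention $\|\cdot\|_{(0),\star}=0$, and associated Capra coupling ¢. Let $\varphi:\{0,1,\dots,d\}\to[-\infty,+\infty]$ be a function and $x\in\mathbb{R}^d$. (1) The Capra-subdifferential of $\varphi\circ\ell_0$ at $x=0$ is $$\partial_{¢}(\varphi\circ\ell_0)(0)=\bigcap_{j\in\{1,\dots,d\}}\big[\varphi(j)\mathbin{\dot{+}}(-\varphi(0))\big]B_{(j),\star},$$ where, by convention, $\lambda B_{(j),\star}=\emptyset$ for any $\lambda\in[-\infty,0)$, and $(+\infty)B_{(j),\star}=\mathbb{R}^d$. (2) The Capra-subdifferential of $\varphi\circ\ell_0$ at $x\neq0$, with $l=\ell_0(x)\ge1$, is given by the following cases: (a) if either $\varphi(l)=-\infty$ or $\varphi\equiv+\infty$, then $\partial_{¢}(\varphi\circ\ell_0)(x)=\mathbb{R}^d$; (b) if $\varphi(l)=+\infty$ and there exists $j\in\{0,1,\dots,d\}$ such that $\varphi(j)\neq+\infty$, then $\partial_{¢}(\varphi\circ\ell_0)(x)=\emptyset$; (c) if $-\infty<\varphi(l)<+\infty$, then, for $y\in\mathbb{R}^d$, $$y\in\partial_{¢}(\varphi\circ\ell_0)(x)\iff\begin{cases}y\in N_{B_{(l)}}\Big(\dfrac{x}{\|x\|_{(l)}}\Big)\quad\text{and}\\[2mm]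 l\in\mathop{\mathrm{arg\,max}}_{j\in\{0,1,\dots,d\}}\big[\|y\|_{(j),\star}-\varphi(j)\big].\end{cases}$$
   Context: $d\ge 1$ is an integer and $\langle\cdot,\cdot\rangle$ is the Euclidean scalar product on $\mathbb{R}^d$. For $x\in\mathbb{R}^d$, $\ell_0(x)\in\{0,\dots,d\}$ is the number of nonzero components of $x$. For $K\subset\{1,\dots,d\}$, $\mathcal{R}_K=\{x\in\mathbb{R}^d : x_j=0\ \forall j\notin K\}$, and for $y\in\mathbb{R}^d$, $y_K\in\mathcal{R}_K$ coincides with $y$ on the components in $K$ and is zero outside $K$. For $K\subset\{1,\dots,d\}$ and $y\in\mathcal{R}_K$, $\|y\|_{K,\star}=\sup\{\langle x,y\rangle : x\in\mathcal{R}_K,\ \|x\|\le 1\}$. The dual coordinate-$k$ norm is $\|y\|_{(k),\star}=\sup_{K\subset\{1,\dots,d\},\,|K|\le k}\|y_K\|_{K,\star}$ for $y\in\mathbb{R}^d$ (this is a norm), and the coordinate-$k$ norm is the norm whose dual norm is $\|\cdot\|_{(k),\star}$: $\|x\|_{(k)}=\sup\{\langle x,y\rangle:\|y\|_{(k),\star}\le 1\}$. $B_{(k)}=\{x:\|x\|_{(k)}\le1\}$, $B_{(k),\star}=\{y:\|y\|_{(k),\star}\le1\}$. Lower and upper Moreau additions $\mathbin{\underset{\cdot}{+}}$ and $\mathbin{\dot{+}}$ extend the usual addition to $[-\infty,+\infty]$ with $(+\infty)\mathbin{\underset{\cdot}{+}}(-\infty)=(-\infty)\mathbin{\underset{\cdot}{+}}(+\infty)=-\infty$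 and $(+\infty)\mathbin{\dot{+}}(-\infty)=(-\infty)\mathbin{\dot{+}}(+\infty)=+\infty$. The Capra coupling ¢ associated with $\|\cdot\|$ is $¢:\mathbb{R}^d\times\mathbb{R}^d\to\mathbb{R}$, $¢(x,y)=\langle x,y\rangle/\|x\|$ if $x\ne0$, $¢(0,y)=0$. For $f:\mathbb{R}^d\to[-\infty,+\infty]$, the ¢-conjugate is $f^{¢}(y)=\sup_{x\in\mathbb{R}^d}\big(¢(x,y)\mathbin{\underset{\cdot}{+}}(-f(x))\big)$, and the Capra-subdifferential of $f$ at $x$ is $$\partial_{¢}f(x)=\big\{y\in\mathbb{R}^d: f^{¢}(y)=¢(x,y)\mathbin{\underset{\cdot}{+}}(-f(x))\big\}.$$ The normal cone to a nonempty closed convex set $C\subset\mathbb{R}^d$ at $x\in C$ is $N_C(x)=\{y\in\mathbb{R}^d:\langle x'-x,y\rangle\le0\ \ \forall x'\in C\}$. *)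

(* Defs.v *)
From mathcomp Require Export all_boot all_order all_algebra.
From mathcomp Require Export boolp classical_sets reals constructive_ereal ereal.

Set Implicit Arguments.
Unset Strict Implicit.
Unset Printing Implicit Defensive.

Import Order.TTheory GRing.Theory Num.Theory.

Local Open Scope classical_set_scope.
Local Open Scope ring_scope.

Section Defs.
Variables (R : realType) (d : nat).
Implicit Types (x y : 'rV[R]_d) (N : 'rV[R]_d -> R) (K : {set 'I_d}).

(* Norms as functions, since the source norm is an arbitrary one and several
   norms live on the same carrier; nonnegativity follows from these axioms. *)
Record is_norm N : Prop := IsNorm {
  is_norm_triangle : forall x y, N (x + y) <= N x + N y ;
  is_norm_homog : forall (a : R) x, N (a *: x) = `|a| * N x ;
  is_norm_definite : forall x, N x = 0 -> x = 0 }.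

Definition dot x y : R := \sum_(j < d) x 0 j * y 0 j.

Lemma supp_card_lt x : (#|[pred j | x 0%R j != 0%R]| < d.+1)%N.
Proof. by rewrite ltnS -[leqRHS]card_ord max_card. Qed.

Definition l0 x : 'I_d.+1 := Ordinal (supp_card_lt x).

Definition coord_space K : set 'rV[R]_d := [set x | forall j, j \notin K -> x 0 j = 0].

Definition coord_restr K y : 'rV[R]_d := \row_j (if j \in K then y 0 j else 0).

(* When N is a norm, every real [sup] below is that of a nonempty set that is
   bounded above (all norms on R^d are equivalent), except in [coord_norm] at
   k = 0, which is meaningless and never used. *)
Definition dual_norm_on N K y : R :=
  sup [set dot x y | x in coord_space K `&` [set x | N x <= 1]].

Definition dual_coord_norm N (k : nat) y : R :=
  if k is 0%N then 0
  else sup [set dual_norm_on N K (coord_restr K y) |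
              K in [set K : {set 'I_d} | (#|K| <= k)%N]].

Definition coord_norm N (k : nat) x : R :=
  sup [set dot x y | y in [set y | dual_coord_norm N k y <= 1]].

Definition coord_ball N (k : nat) : set 'rV[R]_d := [set x | coord_norm N k x <= 1].

Definition dual_coord_ball N (k : nat) : set 'rV[R]_d :=
  [set y | dual_coord_norm N k y <= 1].

Definition capra N x y : R := if x == 0 then 0 else dot x y / N x.

(* On \bar R, the addition of %E is the lower Moreau addition
   (+oo + -oo = -oo) and that of %dE the upper one (+oo + -oo = +oo). *)
Definition capra_conj N (f : 'rV[R]_d -> \bar R) y : \bar R :=
  ereal_sup (range (fun x => (capra N x y)%:E + - f x)%E).

Definition capra_subdiff N (f : 'rV[R]_d -> \bar R) x : set 'rV[R]_d :=
  [set y | capra_conj N f y = ((capra N x y)%:E + - f x)%E].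

Definition escale_set (a : \bar R) (B : set 'rV[R]_d) : set 'rV[R]_d :=
  match a with
  | r%:E%E => if r < 0 then set0 else [set r *: y | y in B]
  | +oo%E => setT
  | -oo%E => set0
  end.

Definition normal_cone (C : set 'rV[R]_d) x : set 'rV[R]_d :=
  [set y | forall x', C x' -> dot (x' - x) y <= 0].

Definition argmax (I : Type) (g : I -> \bar R) : set I :=
  [set i | forall j, (g j <= g i)%E].

End Defs.

(* Main.v *)
Require Import Defs.
From mathcomp Require Import lra.

(** The Capra coupling is constant along rays and [l0] is too, so the conjugate
    of [phi \o l0] at [y] can be computed level by level.  On the vectors with
    exactly [j] nonzero components, the supremum of [<u, y> / N u] is the dual
    coordinate norm of [y]: by definition that norm is the supremum over the
    vectors with at most [j] nonzero components, and these are limits of vectors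
    with exactly [j] of them ([sparse_bound_level]).  Hence the conjugate is the
    maximum over [j] of [dual_coord_norm N j y - phi j] ([capra_conj_le]), and
    [y] is a subgradient at [x] iff each of these numbers is at most
    [capra N x y - phi (l0 x)] ([capra_subdiffP]).

    At [x = 0] this reads [dual_coord_norm N j y <= phi j - phi 0] for all [j],
    with the upper addition on the right, which is membership in a scaled dual
    ball.  At [x != 0] with [phi (l0 x)] infinite, the right-hand side
    [capra N x y - phi (l0 x)] is infinite and the cases are read off.  When
    [phi (l0 x)] is finite, put [l = l0 x]; since
    [capra N x y <= dual_coord_norm N l y] always holds, the condition splits
    into equality there and [l] being a maximizer.  The equality is the normal
    cone condition, for two reasons: the support function of the ball
    [coord_ball N l] is [dual_coord_norm N l], and [coord_norm N l] agrees with
    [N] on vectors with at most [l] nonzero components ([coord_norm_sparse]).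

    The last fact requires, for each [x], a linear form bounded by [N] that takes
    the value [N x] at [x]: the finite-dimensional Hahn-Banach theorem
    ([sublinear_support]).  The same theorem yields, without any topology, that
    every linear form is bounded with respect to [N] ([form_bounded]), so that
    the real suprema in the definitions are genuine. *)

Set Implicit Arguments.
Unset Strict Implicit.
Unset Printing Implicit Defensive.

Import Order.TTheory GRing.Theory Num.Theory.

Local Open Scope classical_set_scope.
Local Open Scope ring_scope.

(** * The scalar product *)

Section Dot.
Variables (R : realType) (d : nat).
Implicit Types u v w y : 'rV[R]_d.

Lemma dot_mx u y : dot u y = (u *m y^T) 0 0.
Proof. by rewrite mxE; apply: eq_bigr => j _; rewrite mxE. Qed.

Lemma dotDl u v y : dot (u + v) y = dot u y + dot v y.
Proof. by rewrite !dot_mx mulmxDl mxE. Qed.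

Lemma dotDr u v y : dot y (u + v) = dot y u + dot y v.
Proof. by rewrite !dot_mx linearD mulmxDr mxE. Qed.

Lemma dotZl a u y : dot (a *: u) y = a * dot u y.
Proof. by rewrite !dot_mx -scalemxAl mxE. Qed.

Lemma dotZr a u y : dot u (a *: y) = a * dot u y.
Proof. by rewrite !dot_mx linearZ -scalemxAr mxE. Qed.

Lemma dotNl u y : dot (- u) y = - dot u y.
Proof. by rewrite -scaleN1r dotZl mulN1r. Qed.

Lemma dot0l y : dot 0 y = 0.
Proof. by rewrite -(scale0r (0 : 'rV[R]_d)) dotZl mul0r. Qed.

Lemma dot0r y : dot y 0 = 0.
Proof. by rewrite -(scale0r (0 : 'rV[R]_d)) dotZr mul0r. Qed.

Lemma dot_deltal i y : dot (delta_mx 0 i) y = y 0 i.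
Proof.
rewrite /dot (bigD1 i) //= big1 ?addr0 => [|j /negbTE neji].
  by rewrite mxE !eqxx mul1r.
by rewrite mxE neji mul0r.
Qed.

End Dot.

(** * Linear forms below a sublinear function *)

Section HahnBanach.
Variables (R : realType) (d : nat).
Implicit Types (p q : 'rV[R]_d -> R) (u v x y : 'rV[R]_d).

Definition sublinear p :=
  (forall u v, p (u + v) <= p u + p v) /\
  (forall c u, 0 <= c -> p (c *: u) = c * p u).

Lemma sublinear0 p : sublinear p -> p 0 = 0.
Proof. by move=> [_ pZ]; rewrite -(scale0r (0 : 'rV[R]_d)) pZ ?mul0r. Qed.

Lemma sublinearN_ge p u : sublinear p -> - p u <= p (- u).
Proof.
move=> hp; have := hp.1 u (- u); rewrite subrr (sublinear0 hp) => h.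
by rewrite -subr_ge0 opprK addrC.
Qed.

(** One step of Hahn-Banach.  The largest sublinear function below [p] whose
    value at [- v] is [- p v] is the infimum over [t >= 0] of
    [p (u + t *: v) - t * p v].  Lowering [p] in this way replaces the usual
    extension of a form from a subspace, so that no subspace has to be handled.
    *)
Lemma sublinear_straighten p v : sublinear p ->
  exists q, [/\ sublinear q, forall u, q u <= p u & q (- v) <= - p v].
Proof.
move=> hp; have [pD pZ] := hp.
pose A u := [set p (u + t *: v) - t * p v | t in [set t : R | 0 <= t]].
have lbA u : lbound (A u) (- p (- u)).
  (* t v = (u + t v) + (- u), hence t p(v) <= p (u + t v) + p (- u). *)
  move=> _ [t /= t0 <-]; rewrite -pZ // lerBrDr addrC.
  by rewrite -[leLHS]/(p (t *: v) - _) lerBlDr -{1}(addKr u (t *: v)) addrC pD.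
have hlb u : has_lbound (A u) by exists (- p (- u)).
have A0 u : A u (p u) by exists 0 => //=; rewrite scale0r mul0r addr0 subr0.
pose q u := inf (A u).
have qle u (t : R) : 0 <= t -> q u <= p (u + t *: v) - t * p v.
  by move=> t0; apply: ge_inf => //; exists t.
have leq u (b : R) : (forall t : R, 0 <= t -> b <= p (u + t *: v) - t * p v) -> b <= q u.
  move=> h; apply: lb_le_inf; first by exists (p u).
  by move=> _ [t /= t0 <-]; exact: h.
have qlep u : q u <= p u by apply: ge_inf.
have q0 : q 0 = 0.
  apply: le_anti; rewrite -{1}(sublinear0 hp) qlep /=; apply: leq => t t0.
  by rewrite add0r pZ // subrr.
have qZle (c : R) u : 0 < c -> q (c *: u) <= c * q u.
  move=> c0; rewrite -ler_pdivrMl //; apply: leq => t t0.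
  rewrite ler_pdivrMl // mulrBr -(pZ c) ?(ltW c0) // scalerDr scalerA mulrA.
  by apply: qle; rewrite mulr_ge0 // ltW.
exists q; split => //; last first.
  by have := qle (- v) 1 ler01; rewrite scale1r addNr (sublinear0 hp) sub0r mul1r.
split=> [u w|c u].
  rewrite -lerBlDr; apply: (leq u) => t t0; rewrite lerBlDr -lerBlDl.
  apply: (leq) => s s0; rewrite lerBlDl.
  have := qle (u + w) (t + s) (addr_ge0 t0 s0).
  have -> : u + w + (t + s) *: v = u + t *: v + (w + s *: v).
    by rewrite scalerDl addrACA.
  by have := pD (u + t *: v) (w + s *: v); lra.
rewrite le_eqVlt => /predU1P[<-|c0]; first by rewrite scale0r q0 mul0r.
apply: le_anti; rewrite qZle //= -ler_pdivlMl //.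
rewrite -{1}(scalerK (lt0r_neq0 c0) u); apply: qZle.
by rewrite invr_gt0.
Qed.

(** Straightening along one vector does not spoil the previous ones: going down
    from [q] to [r] preserves [q (- v) <= - q v], because both sides move the
    right way. *)
Lemma sublinear_straighten_seq p (s : seq 'rV[R]_d) : sublinear p ->
  exists q, [/\ sublinear q, forall u, q u <= p u &
                forall v, v \in s -> q (- v) <= - q v].
Proof.
elim: s p => [|v s IHs] p hp; first by exists p.
have [q [hq qp qv]] := sublinear_straighten v hp.
have [r [hr rq rs]] := IHs q hq.
exists r; split=> // [u|w]; first exact: le_trans (qp u).
rewrite inE => /predU1P[->|/rs//].
apply: le_trans (rq _) (le_trans qv _).
by rewrite lerN2 (le_trans (rq _)).
Qed.

(** A sublinear [q] that is odd on the basis lies below the form with the same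
    values on the basis, by subadditivity; applied at [- u], this also puts the
    form below [q]. *)
Lemma sublinear_odd_basis q : sublinear q ->
  (forall i, q (- delta_mx 0 i) <= - q (delta_mx 0 i)) ->
  forall u, q u = dot u (\row_i q (delta_mx 0 i)).
Proof.
move=> hq odd_e; have [qD qZ] := hq.
set y := \row_i _.
have q_le u : q u <= dot u y.
  have qsum (I : Type) (r : seq I) (F : I -> 'rV[R]_d) :
      q (\sum_(i <- r) F i) <= \sum_(i <- r) q (F i).
    elim/big_ind2: _ => // [|a a' b b' ha hb]; first by rewrite (sublinear0 hq).
    by apply: le_trans (qD _ _) _; apply: lerD.
  rewrite {1}(row_sum_delta u); apply: le_trans (qsum _ _ _) _.
  apply: ler_sum => i _; rewrite [y 0 i]mxE.
  have [u0|u0] := leP 0 (u 0 i); first by rewrite qZ.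
  rewrite -[u 0 i *: _]opprK -scaleNr -scalerN qZ ?oppr_ge0 ?(ltW u0) //.
  by rewrite -[leRHS]mulrNN ler_wpM2l // oppr_ge0 ltW.
move=> u; apply: le_anti; rewrite q_le /=.
rewrite -[leLHS]opprK -dotNl lerNl.
by apply: le_trans _ (q_le (- u)); apply: sublinearN_ge.
Qed.

(** Hahn-Banach.  Straightening along [x] at the very beginning is what forces
    the final form to reach [p x]. *)
Lemma sublinear_support p x : sublinear p ->
  exists y, dot x y = p x /\ forall u, dot u y <= p u.
Proof.
move=> hp; have [q [hq qp qx]] := sublinear_straighten x hp.
have [r [hr rq rodd]] :=
  sublinear_straighten_seq [seq delta_mx 0 i | i <- enum 'I_d] hq.
have rE := sublinear_odd_basis hr _.
exists (\row_i r (delta_mx 0 i)).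
have {}rE u : r u = dot u (\row_i r (delta_mx 0 i)).
  by apply: rE => i; apply: rodd; rewrite map_f ?mem_enum.
have rp u : r u <= p u by apply: le_trans (qp u).
split=> [|u]; last by rewrite -rE.
rewrite -rE; apply: le_anti; rewrite rp /=.
rewrite -[leLHS]opprK lerNl rE.
by rewrite -dotNl -rE; apply: le_trans (rq _) qx.
Qed.

End HahnBanach.

(** * Linear forms and norms *)

Section Norm.
Variables (R : realType) (d : nat) (N : 'rV[R]_d -> R).
Hypothesis hN : is_norm N.
Implicit Types u v x y : 'rV[R]_d.

Lemma norm_sublinear : sublinear N.
Proof.
split; first exact: is_norm_triangle.
by move=> c u c0; rewrite is_norm_homog // ger0_norm.
Qed.

Lemma norm0 : N 0 = 0.
Proof. exact: sublinear0 norm_sublinear. Qed.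

Lemma normN u : N (- u) = N u.
Proof. by rewrite -scaleN1r is_norm_homog // normrN1 mul1r. Qed.

Lemma norm_ge0 u : 0 <= N u.
Proof. by have := sublinearN_ge u norm_sublinear; rewrite normN; lra. Qed.

Lemma norm_gt0 u : u != 0 -> 0 < N u.
Proof.
move=> u0; rewrite lt_neqAle norm_ge0 andbT eq_sym.
by apply: contra_neq u0 => /(is_norm_definite hN).
Qed.

Lemma norm_normalize u : u != 0 -> N ((N u)^-1 *: u) = 1.
Proof.
move=> /norm_gt0 u0; rewrite is_norm_homog // normfV ger0_norm ?norm_ge0 //.
by rewrite mulVf // gt_eqF.
Qed.

(** Boundedness of the linear form [u |-> dot u y] with respect to [N]. *)
Definition bounded_form y := exists C, forall u, dot u y <= C * N u.

Lemma bounded_formD y z :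
  bounded_form y -> bounded_form z -> bounded_form (y + z).
Proof.
move=> [C hC] [D hD]; exists (C + D) => u.
by rewrite dotDr mulrDl lerD.
Qed.

Lemma bounded_formZ a y : bounded_form y -> bounded_form (a *: y).
Proof.
move=> [C hC]; exists (C * `|a|) => u.
by rewrite dotZr -dotZl -mulrA -is_norm_homog.
Qed.

(** Bounded forms span everything: if [r < d] independent bounded forms are
    given, some [x != 0] is annihilated by all of them, and a form supporting
    [N] at [x] is bounded and does not vanish at [x], so that it is independent
    of the others. *)
Lemma bounded_form_free r : (r <= d)%N ->
  exists A : 'M[R]_(r, d), row_free A /\ forall i, bounded_form (row i A).
Proof.
elim: r => [|r IHr] ler; first by exists 0; split=> [|[]//]; rewrite /row_free mxrank0.
have [A [freeA bA]] := IHr (ltnW ler).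
have : kermx A^T != 0.
  rewrite kermx_eq0 /row_free mxrank_tr; apply: contraTneq ler => <-.
  by rewrite -ltnNge ltnS (eqP freeA).
move=> /rowV0Pn[x /sub_kermxP xA x0].
have [y [xy uy]] := sublinear_support x norm_sublinear.
exists (col_mx y A); split.
  rewrite /row_free eqn_leq rank_leq_row -{1}(eqP freeA).
  have -> : \rank (col_mx y A) = \rank (A + y)%MS by rewrite addsmxC addsmxE.
  have : (A < A + y)%MS.
    rewrite ltmxE addsmxSl addsmx_sub submx_refl /=; apply/negP => /submxP[c yE].
    suff : N x = 0 by apply/eqP; rewrite gt_eqF // norm_gt0.
    by rewrite -xy dot_mx yE trmx_mul mulmxA xA mul0mx mxE.
  by rewrite ltmxErank => /andP[].
move=> i; rewrite -[i](splitK (m := 1)); case: split => j /=.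
  rewrite (rowKu j y A) [j]ord1.
  by rewrite row_id; exists 1 => u; rewrite mul1r.
by rewrite (rowKd j y A).
Qed.

(** The half of the equivalence of norms on [R^d] that makes the dual norms
    finite. *)
Lemma form_bounded y : exists2 C, 0 <= C & forall u, dot u y <= C * N u.
Proof.
have [A [freeA bA]] := bounded_form_free (leqnn d).
have : (y <= A)%MS by apply: submx_full; rewrite /row_full.
move=> /submxP[c ->].
have [C hC] : bounded_form (c *m A).
  rewrite mulmx_sum_row; elim/big_ind: _ => //.
  - by exists 0 => u; rewrite dot0r mul0r.
  - exact: bounded_formD.
  - by move=> i _; apply: bounded_formZ.
exists `|C| => // u; apply: le_trans (hC u) _.
by rewrite ler_wpM2r ?norm_ge0 ?ler_norm.
Qed.

End Norm.

(** * Coordinate norms through sparse vectors *)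

Section CoordNorm.
Variables (R : realType) (d : nat) (N : 'rV[R]_d -> R).
Hypothesis hN : is_norm N.
Implicit Types (u v x y : 'rV[R]_d) (k : nat) (M : R).

Lemma l0_eq0 u : (l0 u == 0 :> nat) = (u == 0).
Proof.
rewrite -[LHS]/(#|[pred j | u 0 j != 0]| == 0%N); apply/pred0P/eqP => [h|-> j].
  by apply/rowP => j; have := h j; rewrite /= mxE => /negbFE/eqP.
by rewrite /= mxE eqxx.
Qed.

Lemma l0Z a u : a != 0 -> l0 (a *: u) = l0 u.
Proof.
move=> a0; apply/val_inj/eq_card => j.
by rewrite !inE mxE mulf_eq0 negb_or a0.
Qed.

Lemma l0_delta (i : 'I_d) : l0 (delta_mx 0 i : 'rV[R]_d) = 1 :> nat.
Proof.
apply: etrans (card1 i); apply: eq_card => j.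
by rewrite !inE mxE eqxx /= pnatr_eq0 eqb0 negbK.
Qed.

(** The homogeneous form of the inequality [dual_coord_norm N k y <= M], for
    [k >= 1]; see [dual_coord_norm_le]. *)
Definition sparse_bound k y M :=
  forall u, (l0 u <= k)%N -> dot u y <= M * N u.

Lemma sparse_bound_coord k y M (i : 'I_d) : (1 <= k)%N -> sparse_bound k y M ->
  `|y 0 i| <= M * N (delta_mx 0 i).
Proof.
move=> k1 hM; have e1 : (l0 (delta_mx 0%R i : 'rV[R]_d) <= k)%N by rewrite l0_delta.
rewrite ler_norml lerNl -(dot_deltal i y) -dotNl -{1}(normN hN) !hM //.
by rewrite -scaleN1r l0Z // oppr_eq0 oner_eq0.
Qed.

Lemma delta_mx_neq0 (i : 'I_d) : delta_mx 0 i != 0 :> 'rV[R]_d.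
Proof. by rewrite -l0_eq0 l0_delta. Qed.

Lemma sparse_bound_ge0 k y M :
  (1 <= d)%N -> (1 <= k)%N -> sparse_bound k y M -> 0 <= M.
Proof.
move=> d0 k1 hM; pose i := Ordinal d0.
rewrite -(pmulr_lge0 _ (norm_gt0 hN (delta_mx_neq0 i))).
exact: le_trans (normr_ge0 _) (sparse_bound_coord i k1 hM).
Qed.

Lemma dot_coord_restr (K : {set 'I_d}) u y :
  coord_space K u -> dot u (coord_restr K y) = dot u y.
Proof.
move=> Ku; apply: eq_bigr => j _; rewrite mxE.
by case: ifPn => // /Ku ->; rewrite !mul0r.
Qed.

Lemma coord_space_l0 (K : {set 'I_d}) u : coord_space K u -> (l0 u <= #|K|)%N.
Proof.
move=> Ku; apply/subset_leq_card/fintype.subsetP => j; rewrite !inE => uj.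
by apply: contraNT uj => /Ku ->.
Qed.

Lemma coord_space_support u : coord_space [set j | u 0 j != 0]%SET u.
Proof. by move=> j; rewrite inE negbK => /eqP. Qed.

(** The iterated supremum over supports and over unit balls collapses to a single
    family of inequalities, since the vectors in some [R_K] with [#|K| <= k] are
    those with at most [k] nonzero components.  Every later use of the dual
    coordinate norms goes through this equivalence; the boundedness of linear
    forms is what makes both suprema upper bounds. *)
Lemma dual_coord_norm_le k y M : (1 <= d)%N -> (1 <= k)%N ->
  dual_coord_norm N k y <= M <-> sparse_bound k y M.
Proof.
case: k => // k d1 k1.
have [C C0 hC] := form_bounded hN y.
pose S (K : {set 'I_d}) :=
  [set dot u (coord_restr K y) | u in coord_space K `&` [set u | N u <= 1]].
have S_le K D : 0 <= D -> (forall u, coord_space K u -> dot u y <= D * N u) ->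
    ubound (S K) D.
  move=> D0 hD _ [u [Ku /= Nu] <-]; rewrite dot_coord_restr //.
  by apply: le_trans (hD u Ku) _; rewrite ler_piMr.
have S0 K : S K !=set0.
  by exists 0; exists 0; rewrite ?dot0l //; split=> [j _|] /=; rewrite ?mxE ?norm0.
have supS_le (K : {set 'I_d}) : sup (S K) <= C.
  by apply: ge_sup => //; apply: S_le.
pose T := [set dual_norm_on N K (coord_restr K y) |
             K in [set K : {set 'I_d} | (#|K| <= k.+1)%N]].
have Tub : has_ubound T by exists C => _ [K _ <-]; exact: supS_le.
rewrite -[dual_coord_norm _ _ _]/(sup T); split=> [TM u uk|hM].
  have [->|u0] := eqVneq u 0; first by rewrite dot0l norm0 // mulr0.
  have Nu0 := norm_gt0 hN u0.
  rewrite -ler_pdivrMr // mulrC -dotZl.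
  pose K := [set j | u 0 j != 0]%SET.
  have cardK : #|K| = l0 u by rewrite cardsE.
  have KNu : coord_space K ((N u)^-1 *: u).
    by move=> j /coord_space_support uj; rewrite mxE uj mulr0.
  apply: le_trans TM; apply: (@le_trans _ _ (sup (S K))).
    apply: ub_le_sup.
      by exists C; apply: S_le.
    exists ((N u)^-1 *: u); last by rewrite dot_coord_restr.
    by split=> //=; rewrite norm_normalize.
  by apply: ub_le_sup => //; exists K => //=; rewrite cardK.
have M0 := sparse_bound_ge0 d1 k1 hM.
apply: ge_sup.
  exists (dual_norm_on N finset.set0 (coord_restr finset.set0 y)).
  by exists finset.set0 => //=; rewrite cards0.
move=> _ [K /= cK <-]; apply: (ge_sup (S0 K)); apply: S_le => // u Ku.
by apply: hM; apply: leq_trans (coord_space_l0 Ku) cK.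
Qed.

Lemma dual_coord_norm_bound k y : (1 <= d)%N -> (1 <= k)%N ->
  sparse_bound k y (dual_coord_norm N k y).
Proof. by move=> d1 k1; apply/dual_coord_norm_le. Qed.

Lemma dual_coord_norm_ge0 k y : (1 <= d)%N -> 0 <= dual_coord_norm N k y.
Proof.
case: k => // k d1.
by apply: (@sparse_bound_ge0 k.+1 y) => //; apply: dual_coord_norm_bound.
Qed.

Lemma dual_coord_norm_eq0 k y : (1 <= d)%N -> (1 <= k)%N ->
  dual_coord_norm N k y <= 0 -> y = 0.
Proof.
move=> d1 k1 /(dual_coord_norm_le _ _ d1 k1) h; apply/rowP => i.
have := sparse_bound_coord i k1 h.
by rewrite mul0r normr_le0 mxE => /eqP.
Qed.

Lemma dual_coord_normZ k y a : (1 <= d)%N -> (1 <= k)%N -> 0 < a ->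
  (dual_coord_norm N k (a^-1 *: y) <= 1) = (dual_coord_norm N k y <= a).
Proof.
move=> d1 k1 a0; apply/idP/idP => /(dual_coord_norm_le _ _ d1 k1) h;
  apply/dual_coord_norm_le => // u /h.
  by rewrite dotZr mul1r ler_pdivrMl.
by rewrite dotZr mul1r ler_pdivrMl.
Qed.

(** Half of the duality between the two coordinate norms.  It also requires the
    set defining [coord_norm] to be bounded, which holds because the dual unit
    ball bounds every coordinate of its elements. *)
Lemma coord_norm_bound k x y : (1 <= d)%N -> (1 <= k)%N ->
  dot x y <= dual_coord_norm N k y * coord_norm N k x.
Proof.
move=> d1 k1.
have ub1 : forall z, dual_coord_norm N k z <= 1 -> dot x z <= coord_norm N k x.
  move=> z z1; apply: ub_le_sup; last by exists z.
  (* |w_i| <= N (e_i) for w in the dual unit ball. *)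
  exists (\sum_i `|x 0 i| * N (delta_mx 0 i)) => _ [w /= w1 <-].
  apply: ler_sum => i _; apply: le_trans (ler_norm _) _; rewrite normrM.
  rewrite ler_wpM2l // -[leRHS]mul1r.
  by apply: (sparse_bound_coord i k1); apply/dual_coord_norm_le.
have [y0|y0] := leP (dual_coord_norm N k y) 0.
  rewrite (dual_coord_norm_eq0 d1 k1 y0) dot0r.
  apply: mulr_ge0; first exact: dual_coord_norm_ge0.
  rewrite -(dot0r x); apply: ub1; apply/dual_coord_norm_le => // u _.
  by rewrite dot0r mul1r norm_ge0.
by rewrite -ler_pdivrMl // -dotZr ub1 // dual_coord_normZ.
Qed.

(** For [dot x y] with [x] sparse, the constraint [dual_coord_norm N k y <= 1]
    gives the bound [N x]; this bound is attained since a form that supports [N]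
    at [x] lies below [N] on all vectors, in particular on the sparse ones. *)
Lemma coord_norm_sparse k x : (1 <= d)%N -> (1 <= k)%N -> (l0 x <= k)%N ->
  coord_norm N k x = N x.
Proof.
move=> d1 k1 xk; apply: le_anti.
have ubN : ubound [set dot x y | y in [set y | dual_coord_norm N k y <= 1]] (N x).
  move=> _ [y /= /(dual_coord_norm_le _ _ d1 k1) y1 <-].
  by rewrite -[leRHS]mul1r y1.
have [y [xy uy]] := sublinear_support x (norm_sublinear hN).
have Sy : [set dot x y | y in [set y | dual_coord_norm N k y <= 1]] (N x).
  by exists y => //=; apply/dual_coord_norm_le => // u _; rewrite mul1r.
apply/andP; split; first by apply: ge_sup => //; exists (N x).
by apply: ub_le_sup => //; exists (N x).
Qed.

Lemma l0_succ u : (l0 u < d)%N ->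
  exists i, forall e, e != 0 -> l0 (u + e *: delta_mx 0 i) = (l0 u).+1 :> nat.
Proof.
move=> ud; have [i ui] : exists i, u 0 i = 0.
  apply: contrapT => /forallNP u0; move: ud.
  rewrite [X in (X < _)%N](_ : _ = d) ?ltnn // -[RHS]card_ord.
  by apply: eq_card => j; rewrite !inE; apply/eqP/u0.
exists i => e e0; rewrite /= (cardD1 i) inE !mxE ui add0r !eqxx mulr1 e0 add1n.
congr _.+1; apply: eq_card => j; rewrite !inE !mxE eqxx /=.
by have [->|ji] := eqVneq j i; rewrite ?ui ?eqxx // mulr0 addr0.
Qed.

Lemma l0_surj k : (k <= d)%N -> exists u, l0 u = k :> nat.
Proof.
elim: k => [_|k IHk kd]; first by exists 0; apply/eqP; rewrite l0_eq0.
have [u uk] := IHk (ltnW kd).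
have [i ui] : exists i, forall e, e != 0 ->
    l0 (u + e *: delta_mx 0 i) = (l0 u).+1 :> nat by apply: l0_succ; rewrite uk.
by exists (u + 1 *: delta_mx 0 i); rewrite ui ?oner_eq0 // uk.
Qed.

(** Vectors with exactly [k] nonzero components are dense among those with at
    most [k].  Adding one nonzero coordinate at a time, each step is a limit in a
    single real parameter [e]. *)
Lemma sparse_bound_level k y M : (k <= d)%N ->
  (forall u, l0 u = k :> nat -> dot u y <= M * N u) -> sparse_bound k y M.
Proof.
move=> kd hM u uk.
have [k0|k0] := posnP k.
  by apply: hM; apply/eqP; move: uk; rewrite k0 leqn0.
have M0 : 0 <= M.
  (* Both v and - v lie in the level set. *)
  have [v vk] := l0_surj kd.
  have v0 : v != 0 by rewrite -l0_eq0 vk -lt0n.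
  have := hM v vk; have := hM (- v); rewrite -scaleN1r l0Z ?oppr_eq0 ?oner_eq0 //.
  rewrite scaleN1r dotNl normN // => /(_ vk) h1 h2.
  by rewrite -(pmulr_lge0 _ (norm_gt0 hN v0)); lra.
move: uk; have [n] := ubnP (k - l0 u)%N; elim: n u => // n IHn u un uk.
have [/hM//|uk'] := eqVneq (l0 u : nat) k.
have {uk'}ltuk : (l0 u < k)%N by rewrite ltn_neqAle uk'.
have [i ui] := l0_succ (leq_trans ltuk kd).
set w := delta_mx 0 i : 'rV[R]_d in ui.
have bound e : 0 < e -> dot u y + e * dot w y <= M * N u + e * (M * N w).
  move=> e0; rewrite -dotZl -dotDl; apply: (@le_trans _ _ (M * N (u + e *: w))).
    apply: IHn; rewrite ui ?gt_eqF //.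
    by rewrite subnS -ltnS prednK // subn_gt0.
  rewrite mulrCA -mulrDr ler_wpM2l //.
  apply: le_trans (is_norm_triangle hN _ _) _.
  by rewrite is_norm_homog // gtr0_norm.
apply/ler_addgt0Pr => e e0.
(* The bound at e / c exceeds the wanted one by at most e. *)
pose c := `|M * N w - dot w y| + 1.
have c0 : 0 < c by rewrite ltr_wpDl.
have := bound (e / c) (divr_gt0 e0 c0).
have : e / c * (M * N w - dot w y) <= e.
  rewrite mulrAC ler_pdivrMr // ler_wpM2l ?(ltW e0) //.
  by rewrite (le_trans (ler_norm _)) // lerDl.
by rewrite mulrBr; lra.
Qed.
End CoordNorm.

(** * Capra conjugate and subdifferential *)

Section CapraConjugate.
Variables (R : realType) (d : nat) (N : 'rV[R]_d -> R).
Hypotheses (hd : (1 <= d)%N) (hN : is_norm N).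
Variable phi : 'I_d.+1 -> \bar R.
Implicit Types (x y u : 'rV[R]_d).

Lemma l00 : l0 (0 : 'rV[R]_d) = ord0.
Proof. by apply/val_inj/eqP; rewrite /= l0_eq0. Qed.

Lemma capra_le_dual_coord_norm u y : capra N u y <= dual_coord_norm N (l0 u) y.
Proof.
rewrite /capra; case: eqP => [->|/eqP u0]; first by rewrite l00.
rewrite ler_pdivrMr ?norm_gt0 //; apply: dual_coord_norm_bound => //.
by rewrite lt0n l0_eq0.
Qed.

(** Level-by-level computation of the conjugate.  It is phrased with an arbitrary
    upper bound [M], rather than as an equality of suprema, so that the infinite
    values of [phi] and [M] are dealt with by direct inspection. *)
Lemma capra_conj_le y (M : \bar R) :
  (capra_conj N (phi \o @l0 R d) y <= M)%E <->
  forall j : 'I_d.+1, ((dual_coord_norm N j y)%:E - phi j <= M)%E.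
Proof.
split=> [conjM j|hM]; last first.
  apply: ge_ereal_sup => _ [u _ <-]; apply: le_trans (hM (l0 u)).
  by rewrite leeD2r // lee_fin capra_le_dual_coord_norm.
have {conjM}hM u : ((capra N u y)%:E - phi (l0 u) <= M)%E.
  by apply: le_trans conjM; apply: ereal_sup_ubound; exists u.
have [j0|j0] := posnP j.
  have -> : j = l0 (0 : 'rV[R]_d) by rewrite l00; apply: val_inj.
  by have := hM 0; rewrite /capra eqxx l00.
have jd : (j <= d)%N by rewrite -ltnS.
(* A single vector of level j settles the cases phi j = -oo and M = -oo. *)
have [v vj] := l0_surj R jd; have {}vj : l0 v = j by apply: val_inj.
case phij : (phi j) => [r| |]; last first.
- by have := hM v; rewrite vj phij.
- by rewrite leNye.
have := hM v; rewrite vj phij; case: M hM => [m| |] hM //; last first.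
  by move=> _; rewrite leey.
move=> _; rewrite -EFinB lee_fin lerBlDr; apply/dual_coord_norm_le => //.
apply: sparse_bound_level => // u uj.
have u0 : u != 0 by rewrite -l0_eq0 uj -lt0n.
have {}uj : l0 u = j by apply: val_inj.
have := hM u; rewrite uj phij /capra (negbTE u0) -EFinB lee_fin lerBlDr.
by rewrite ler_pdivrMr // norm_gt0.
Qed.

(** The term at [x] is one of those in the supremum, so equality in the
    definition of the subdifferential amounts to the inequality [<=]. *)
Lemma capra_subdiffP x y :
  capra_subdiff N (phi \o @l0 R d) x y <->
  forall j : 'I_d.+1, ((dual_coord_norm N j y)%:E - phi j <=
             (capra N x y)%:E - phi (l0 x))%E.
Proof.
rewrite /capra_subdiff /= -capra_conj_le; split=> [->//|conj_le].
by apply/le_anti; rewrite conj_le /=; apply: ereal_sup_ubound; exists x.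
Qed.

Lemma escale_dual_coord_ball k (a : \bar R) y : (1 <= k)%N ->
  escale_set a (dual_coord_ball N k) y <-> ((dual_coord_norm N k y)%:E <= a)%E.
Proof.
move=> k1; case: a => [r| |] /=; rewrite ?leey ?lee_fin //.
have n0 := dual_coord_norm_ge0 hN k y hd.
have [r0|r0|->] := ltgtP r 0.
- by split=> // nr; have := le_lt_trans (le_trans n0 nr) r0; rewrite ltxx.
- split=> [[z z1 <-]|nr].
    rewrite -dual_coord_normZ // scalerK ?gt_eqF //.
  exists (r^-1 *: y); last by rewrite scalerKV ?gt_eqF.
  by rewrite /dual_coord_ball /= dual_coord_normZ.
- split=> [[z _ <-]|nr].
    rewrite scale0r; apply/dual_coord_norm_le => // u _.
    by rewrite dot0r mul0r.
  rewrite (dual_coord_norm_eq0 hN hd k1 nr); exists 0; rewrite ?scale0r //.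
  apply/dual_coord_norm_le => // u _.
  by rewrite dot0r mul1r norm_ge0.
Qed.

(** The normal cone at [x'] consists of the [y] whose maximum over the ball,
    which is [dual_coord_norm N k y], is reached at [x'].  The normalized sparse
    vectors lie in the ball and already realize this maximum. *)
Lemma normal_cone_coord_ball k x y : (1 <= k)%N -> (l0 x <= k)%N -> x != 0 ->
  normal_cone (coord_ball N k) ((coord_norm N k x)^-1 *: x) y <->
  dual_coord_norm N k y <= dot x y / N x.
Proof.
move=> k1 xk x0; rewrite coord_norm_sparse //.
have dot_normalized x' :
    dot (x' - (N x)^-1 *: x) y = dot x' y - dot x y / N x.
  by rewrite dotDl dotNl dotZl mulrC.
split=> [cone|nle x' /= x'1].
  apply/dual_coord_norm_le => // u uk.
  have [->|u0] := eqVneq u 0; first by rewrite dot0l norm0 // mulr0.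
  rewrite -ler_pdivrMr ?norm_gt0 // mulrC -dotZl.
  rewrite -subr_le0 -dot_normalized; apply: cone => /=.
  rewrite /coord_ball /= coord_norm_sparse ?norm_normalize //.
  by rewrite l0Z // invr_eq0 gt_eqF // norm_gt0.
rewrite dot_normalized subr_le0; apply: le_trans nle.
apply: le_trans (coord_norm_bound hN x' y hd k1) _.
by rewrite ler_piMr ?dual_coord_norm_ge0.
Qed.

End CapraConjugate.

Theorem proposition4p7 (R : realType) (d : nat) (hd : (1 <= d)%N)
    (N : 'rV[R]_d -> R) (hN : is_norm N)
    (phi : 'I_d.+1 -> \bar R) (x : 'rV[R]_d) :
  (capra_subdiff N (phi \o @l0 R d) 0 =
     \bigcap_(j in [set j : 'I_d.+1 | (1 <= j)%N])
        escale_set (phi j + - phi ord0)%dE (dual_coord_ball N j))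
  /\
  (x != 0 ->
   [/\ (phi (l0 x) = -oo%E \/ (forall j, phi j = +oo%E)) ->
         capra_subdiff N (phi \o @l0 R d) x = setT,
       (phi (l0 x) = +oo%E /\ (exists j, phi j <> +oo%E)) ->
         capra_subdiff N (phi \o @l0 R d) x = set0
     & (-oo < phi (l0 x) < +oo)%E ->
         forall y : 'rV[R]_d,
           capra_subdiff N (phi \o @l0 R d) x y <->
           normal_cone (coord_ball N (l0 x)) ((coord_norm N (l0 x) x)^-1 *: x) y /\
           argmax (fun j : 'I_d.+1 => ((dual_coord_norm N j y)%:E - phi j)%E)
             (l0 x)]).
Proof.
split=> [|x0].
  (* Moving a term across the inequality turns the lower addition into the
     upper one. *)
  have shift (n : R) (a b : \bar R) :
      ((n%:E - a <= 0%:E - b) = (n%:E <= (a + - b)%dE))%E.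
    case: a => [a| |]; case: b => [b| |] //=; rewrite ?leey ?leNye //.
    by rewrite -!EFinB -DualAddTheoryNumDomain.dEFinB !lee_fin; apply/idP/idP; lra.
  apply/seteqP; split=> y.
    move=> /(capra_subdiffP hd hN); rewrite /capra eqxx l00 => h j j1.
    by apply/escale_dual_coord_ball; rewrite // -shift.
  move=> h; apply/(capra_subdiffP hd hN) => j; rewrite /capra eqxx l00.
  have [j0|j0] := posnP j.
    by have -> : j = ord0 by apply: val_inj.
  by rewrite shift; apply/escale_dual_coord_ball => //; apply: h.
have l1 : (1 <= l0 x)%N by rewrite lt0n l0_eq0.
split=> [hphi|[lphi [j jphi]]|].
- apply/seteqP; split=> // y _; apply/(capra_subdiffP hd hN) => j.
  by case: hphi => [->|->]; rewrite ?leey // leNye.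
- apply/seteqP; split=> // y /(capra_subdiffP hd hN)/(_ j); rewrite lphi /=.
  by case: (phi j) jphi.
case lphi : (phi (l0 x)) => [r| |] // _ y.
have capraE : capra N x y = dot x y / N x by rewrite /capra (negbTE x0).
rewrite normal_cone_coord_ball // capra_subdiffP // lphi capraE.
rewrite /argmax /= lphi; split=> [h|[nle h] j].
  have nle : dual_coord_norm N (l0 x) y <= dot x y / N x.
    by have := h (l0 x); rewrite lphi -!EFinB lee_fin lerD2r.
  split=> // j; apply: le_trans (h j) _.
  by rewrite -!EFinB lee_fin lerD2r -capraE capra_le_dual_coord_norm.
by apply: le_trans (h j) _; rewrite -!EFinB lee_fin lerD2r.
Qed.
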